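(* Let $c\in(0,1]$, let $\mu=\mathrm{MP}_c$ be the Marchenko–Pastur law, $a_\pm=(1\pm\sqrt c)^2$, $b=1+\sqrt c$, and for $z>b$ let $\Delta(z)=\sqrt{(z^2-a_-)(z^2-a_+)}$ (positive branch). For $z>b$, $$\phi(z)=\frac{z^2+c-1-\Delta(z)}{2cz},\qquad\widetilde\phi(z)=\frac{z^2-c+1-\Delta(z)}{2z},\qquad d(z)=\frac{2}{z^2-(1+c)+\Delta(z)}.$$ Consequently $d(b+)=\frac1{\sqrt c}$ and $\theta_\star=c^{1/4}$. For $\theta>c^{1/4}$, $$\rho(\theta)^2=\theta^2+(1+c)+\frac c{\theta^2}=\frac{(1+\theta^2)(c+\theta^2)}{\theta^2},$$ $$\kappa_{\mathrm L}(\theta)=\frac{1-c/\theta^4}{1+c/\theta^2},\qquad\kappa_{\mathrm R}(\theta)=\frac{1-c/\theta^4}{1+1/\theta^2},\qquad\kappa_{\mathrm{LR}}(\theta)=\sqrt{\frac{1-c/\theta^4}{1+c/\theta^2}}\sqrt{\frac{1-c/\theta^4}{1+1/\theta^2}}.$$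
   Context: $\mathrm{MP}_c$ is the probability measure with density $\frac{\sqrt{(a_+-x)(x-a_-)}}{2\pi cx}$ on $[a_-,a_+]$. For a compactly supported probability measure $\mu$ on $[0,\infty)$ with $b=\sqrt{\sup\operatorname{supp}\mu}$ and $z>b$: $\phi(z)=\int\frac{z}{z^2-x}\,\mu(dx)$, $\widetilde\phi(z)=c\,\phi(z)+\frac{1-c}{z}$, $d(z)=\phi(z)\widetilde\phi(z)$; $d$ is positive and strictly decreasing on $(b,\infty)$. $d(b+)=\lim_{z\downarrow b}d(z)$, $\theta_\star=d(b+)^{-1/2}$, and for $\theta>\theta_\star$, $\rho(\theta)=d^{-1}(\theta^{-2})\in(b,\infty)$. For $\theta>\theta_\star$ and $\rho=\rho(\theta)$: $\kappa_{\mathrm L}(\theta)=-\frac{2\phi(\rho)}{\theta^2d'(\rho)}$, $\kappa_{\mathrm R}(\theta)=-\frac{2\widetilde\phi(\rho)}{\theta^2d'(\rho)}$, $\kappa_{\mathrm{LR}}(\theta)=-\frac{2}{\theta^3d'(\rho)}$. *)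

(* Defs.v *)
From HB Require Import structures.
From mathcomp Require Export all_boot all_order all_algebra.
From mathcomp Require Export all_classical all_reals all_analysis.
From mathcomp Require Export measurable_realfun.

Set Implicit Arguments.
Unset Strict Implicit.
Unset Printing Implicit Defensive.

Export Order.TTheory GRing.Theory Num.Theory.
Export numFieldNormedType.Exports.

Local Open Scope classical_set_scope.
Local Open Scope ring_scope.

Definition mp_lo {R : realType} (c : R) : R := (1 - Num.sqrt c) ^+ 2.
Definition mp_hi {R : realType} (c : R) : R := (1 + Num.sqrt c) ^+ 2.

(* At x = 0, which lies in the interval only for c = 1 (when 0 < c), division
   by zero makes the density 0; this affects a single point. *)
Definition mp_density {R : realType} (c x : R) : R :=
  \1_(`[mp_lo c, mp_hi c]) x *
  (Num.sqrt ((mp_hi c - x) * (x - mp_lo c)) / (2 * pi * c * x)).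

Definition MP {R : realType} (c : R) : set (measurableTypeR R) -> \bar R :=
  fun A => (\int[lebesgue_measure]_(x in A) (mp_density c x)%:E)%E.

Section MP_measure.
Context {R : realType}.
Variable c : R.

Lemma mp_density_ge0 (x : R) : 0 <= mp_density c x.
Proof.
rewrite /mp_density indicE; have [xI|_] := boolP (x \in _); last first.
  by rewrite mul0r.
rewrite mul1r; move: xI; rewrite inE /= in_itv /= => /andP[lx xh].
have x0 : 0 <= x by apply: le_trans lx; exact: sqr_ge0.
have [c0|c0] := leP 0 c.
  by rewrite divr_ge0 ?sqrtr_ge0// !mulr_ge0// pi_ge0.
have xlo : x = mp_lo c.
  apply/le_anti; rewrite lx andbT; apply: le_trans xh _.
  by rewrite /mp_hi /mp_lo (ler0_sqrtr (ltW c0)) addr0 subr0.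
by rewrite {2}xlo subrr mulr0 sqrtr0 mul0r.
Qed.

Lemma measurable_mp_density : measurable_fun setT (mp_density c).
Proof.
rewrite (_ : mp_density c = (fun x => \1_(`[mp_lo c, mp_hi c]) x *
  (Num.sqrt ((mp_hi c - x) * (x - mp_lo c)) *
   ((2 * pi * c)^-1 * x `^ (-1))))); last first.
  apply/funext => x; rewrite /mp_density indicE.
  have [xI|_] := boolP (x \in _); last by rewrite !mul0r.
  move: xI; rewrite inE /= in_itv /= => /andP[lx _].
  by rewrite powR_inv1 ?invfM//; apply: le_trans lx; exact: sqr_ge0.
apply: measurable_funM; first exact: measurable_indic.
apply: measurable_funM; last first.
  by apply: measurable_funM => //; exact: measurable_powR.
apply: (@measurableT_comp _ _ _ _ _ _ (@Num.sqrt R)).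
  by apply: continuous_measurable_fun; exact: sqrt_continuous.
by apply: measurable_funM; apply: measurable_funB.
Qed.

Let MP0 : MP c set0 = 0%E.
Proof. by rewrite /MP integral_set0. Qed.

Let MP_ge0 A : (0 <= MP c A)%E.
Proof. by apply: integral_ge0 => x _; rewrite lee_fin mp_density_ge0. Qed.

Let MP_sigma_additive : semi_sigma_additive (MP c).
Proof.
move=> /= A mA tA mUA; rewrite /MP ge0_integral_bigcup//=.
- apply: is_cvg_ereal_nneg_natsum_cond => n _ _.
  by apply: integral_ge0 => x _; rewrite lee_fin mp_density_ge0.
- by apply: measurable_funTS; apply/measurable_EFinP; exact: measurable_mp_density.
- by move=> x _; rewrite lee_fin mp_density_ge0.
Qed.

HB.instance Definition _ := isMeasure.Build _ _ _
  (MP c) MP0 MP_ge0 MP_sigma_additive.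

End MP_measure.

(* Intended for mu a compactly supported probability measure on [0, +oo[ and
   z > edge mu; dtrans is the product d of the two transforms. *)
Section spiked.
Context {R : realType}.
Variables (c : R) (mu : {measure set (measurableTypeR R) -> \bar R}).

Definition msupport : set R :=
  [set x | forall U : set R, open U -> U x -> (0 < mu U)%E].

Definition edge : R := Num.sqrt (sup msupport).

Definition phi (z : R) : R := (\int[mu]_x (z / (z ^+ 2 - x)))%R.

Definition phit (z : R) : R := c * phi z + (1 - c) / z.

Definition dtrans (z : R) : R := phi z * phit z.

(* d(b+); if d diverges at b, this limit and theta_star are both 0. *)
Definition dtrans_edge : R := lim (dtrans z @[z --> edge^'+]).

Definition theta_star : R := dtrans_edge `^ (- 2^-1).

(* The inverse of d on (b, +oo). *)
Definition rho (theta : R) : R :=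
  'pinv_(fun=> 0) `]edge, +oo[ dtrans (theta ^- 2).

Definition kappaL (theta : R) : R :=
  - (2 * phi (rho theta) / (theta ^+ 2 * dtrans^`()%classic (rho theta))).

Definition kappaR (theta : R) : R :=
  - (2 * phit (rho theta) / (theta ^+ 2 * dtrans^`()%classic (rho theta))).

Definition kappaLR (theta : R) : R :=
  - (2 / (theta ^+ 3 * dtrans^`()%classic (rho theta))).

End spiked.

(* Main.v *)
Require Import Defs.
From mathcomp Require Import ring lra.

(** Put [s = Num.sqrt c].  The density of the Marchenko-Pastur law lives on the
    interval of centre [1 + c] and half-width [2 s], where the substitution
    [x = 1 + c - 2 s cos t] turns the semicircular factor into [2 s sin t] and
    a linear polynomial in [x] into a multiple of
    [|1 - r e^(it)|^2 = 1 + r ^+ 2 - 2 r cos t].  A single integral thus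
    carries the analysis: that of [sin t ^+ 2 / |1 - r e^(it)|^2] over
    [[0, pi]] is [pi / 2] for all nonzero [r] in [[-1, 1]]
    ([integral_semicircle]).
    With [r = s] the linear polynomial is proportional to [x], and the
    integral yields the total mass ([MP_setT]).  With [- r], where
    [s (r + r^-1) = z ^+ 2 - (1 + c)] and [0 < r <= 1], it is proportional to
    [z ^+ 2 - x], and partial fractions give
    [phi z = (1 + r / s) / z] ([phi_MP]).

    Solving the quadratic equation for [r] brings in [Delta], and [phit] and
    [dtrans] follow by algebra.  In particular [dtrans z = r / s] satisfies
    [(dtrans z)^-1 + c * dtrans z = z ^+ 2 - (1 + c)].  Setting
    [dtrans z = theta ^- 2] yields [rho theta ^+ 2] at once, provided that
    [theta ^+ 2] is the larger root of the quadratic, that is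
    [theta ^+ 2 > s] ([dtrans_joukowski]); at such a point
    [Delta = theta ^+ 2 - c / theta ^+ 2].  Differentiating the closed form of
    [dtrans] there gives [- 2 rho / (theta ^+ 4 - c)], from which the three
    values of kappa are field computations. *)

Set Implicit Arguments.
Unset Strict Implicit.
Unset Printing Implicit Defensive.
Import HBNNSimple.

Local Open Scope classical_set_scope.
Local Open Scope ring_scope.

(** * The integral of the semicircle against a Poisson-type kernel *)

(** The substitution [x = q - l cos t].  The integrand may blow up at an end
    of the interval, so the fundamental theorem of calculus is applied on
    the segments [[q - l cos (t n), q + l cos (t n)]] with [t n --> 0], which
    exhaust the interval, and monotone convergence gives the limit.  On such
    a segment the primitive is [A \o acos] composed with an affine map; its
    values at the end points are [A (t n)] and [A (pi - t n)], so that the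
    behaviour of [acos] at [-1] and [1] never matters. *)
Lemma ge0_integral_cos_substitution (R : realType) (q l : R) (f A : R -> R) :
  0 < l ->
  (forall x, q - l < x < q + l -> 0 <= f x) ->
  (forall x, q - l < x < q + l -> {for x, continuous f}) ->
  {for 0, continuous A} -> {for pi, continuous A} ->
  (forall t, 0 < t < pi ->
     is_derive t 1 A (l * sin t * f (q - l * cos t))) ->
  (\int[lebesgue_measure]_(x in `](q - l)%R, (q + l)%R[) (f x)%:E =
   (A pi - A 0)%:E)%E.
Proof.
move=> l0 f0 cf cA0 cApi dA.
pose F x := A (acos ((q - x) / l)).
have Fcos t : 0 <= t <= pi -> F (q - l * cos t) = A t.
  move=> t0pi; rewrite /F opprB addrC subrK mulrAC divff ?gt_eqF// mul1r.
  by rewrite cosK// in_itv.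
have dF x : q - l < x < q + l -> is_derive x 1 F (f x).
  move=> xql; pose u := (q - x) / l.
  have u1 : -1 < u < 1.
    by rewrite /u ltr_pdivlMr// ltr_pdivrMr// mulN1r mul1r; lra.
  have u1' : -1 <= u <= 1 by lra.
  have [tu tpi] : 0 < acos u /\ acos u < pi.
    by split; [apply: acos_gt0|apply: acos_ltpi]; lra.
  have dAu := dA (acos u) (ssrbool.introT andP (conj tu tpi)).
  pose k y : R := (q - y) / l.
  have du : is_derive x 1 k (- l^-1).
    by apply: is_derive_eq; rewrite /GRing.scale/=; ring.
  have dacos := is_derive1_acos u1.
  have := is_derive1_comp (g := acos \o k) dAu (is_derive1_comp (g := k) dacos du).
  rewrite acosK ?in_itv//= -(sin_acos u1').
  have s0 : sin (acos u) != 0 by rewrite gt_eqF// sin_gt0_pi// tu.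
  have -> : l * sin (acos u) * f (q - l * u) *
      (- (sin (acos u))^-1 * - l^-1) = f x.
    have -> : q - l * u = x by rewrite /u; field; rewrite gt_eqF.
    by field; rewrite s0 gt_eqF.
  by [].
pose t n : R := n.+2%:R^-1.
have t_gt0 n : 0 < t n by rewrite invr_gt0.
have t_itv n : 0 < t n < pi / 2.
  have := pi_ge2 R; have : t n <= 2^-1 by rewrite lef_pV2 ?posrE// ler_nat.
  by have := t_gt0 n; lra.
have c_itv n : 0 < cos (t n) < 1.
  have := t_itv n => /andP[t0 tpi].
  rewrite cos_gt0_pihalf/=; last by rewrite tpi; lra.
  by rewrite -[ltRHS]cos0 ltr_cos// in_itv/= ?lexx ?pi_ge0//; lra.
pose I n := `[q - l * cos (t n), q + l * cos (t n)]%classic.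
have I_sub n x : I n x -> q - l < x < q + l.
  rewrite /I/= in_itv/=; have := c_itv n => /andP[c0 c1].
  have : l * cos (t n) < l by rewrite gtr_pMr.
  by lra.
have intI n : (\int[lebesgue_measure]_(x in I n) (f x)%:E =
    (A (pi - t n) - A (t n))%:E)%E.
  have := c_itv n => /andP[c0 c1].
  have ab : q - l * cos (t n) < q + l * cos (t n).
    have : 0 < l * cos (t n) by rewrite mulr_gt0.
    by lra.
  have Fa : F (q - l * cos (t n)) = A (t n).
    by apply: Fcos; have := t_itv n; have := pi_gt0 R; lra.
  have Fb : F (q + l * cos (t n)) = A (pi - t n).
    rewrite -Fcos; last by have := t_itv n; have := pi_gt0 R; lra.
    by rewrite cosB cospi sinpi; congr F; ring.
  rewrite (continuous_FTC2 (F := F) ab) ?Fa ?Fb//.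
  - apply: continuous_in_subspaceT => x; rewrite inE => /I_sub; exact: cf.
  - have dIF x : I n x -> derivable F x 1.
      by move=> /I_sub/dF df; exact: ex_derive.
    have cIF x : I n x -> {for x, continuous F}.
      by move=> /dIF d1; exact/differentiable_continuous/derivable1_diffP.
    split.
    + by move=> x /subset_itv_oo_cc xI; exact: dIF.
    + by apply/cvg_at_right_filter/cIF; rewrite /I/= bound_itvE ltW.
    + by apply/cvg_at_left_filter/cIF; rewrite /I/= bound_itvE ltW.
  - move=> x /subset_itv_oo_cc/I_sub/dF df.
    by rewrite derive1E derive_val.
have t_cvg0 : t n @[n --> \oo] --> (0 : R).
  have := @cvg_harmonic R; rewrite -(cvg_shiftS (@harmonic R)).
  exact.
have bigI : \bigcup_n I n = `]q - l, q + l[%classic.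
  apply/seteqP; split => [x [n _ /I_sub]|x]; rewrite /= in_itv//=.
  move=> xql.
  have c_cvg1 : cos (t n) @[n --> \oo] --> (1 : R).
    rewrite -[X in _ --> X]cos0.
    by apply: continuous_cvg => //; exact: continuous_cos.
  have : \forall n \near \oo, `|(x - q) / l| < cos (t n).
    apply: (cvgr_gt (1 : R)) => //.
    by rewrite normrM normfV (gtr0_norm l0) ltr_pdivrMr// mul1r ltr_norml; lra.
  move=> [n _ /(_ n (leqnn n))/=]; rewrite normrM normfV (gtr0_norm l0).
  rewrite ltr_pdivrMr// ltr_norml => xn; exists n => //.
  by rewrite /I/= in_itv/=; lra.
have lim_IA : (\int[lebesgue_measure]_(x in I n) (f x)%:E)%E @[n --> \oo] -->
    (A pi - A 0)%:E.
  under eq_fun do rewrite intI.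
  apply: cvg_EFin; first exact: nearW.
  apply: cvgB; last exact: continuous_cvg.
  apply: continuous_cvg => //.
  rewrite -[X in _ --> X]subr0.
  by apply: cvgB => //; exact: cvg_cst.
rewrite -bigI; apply: cvg_unique lim_IA => //.
apply: ge0_nondecreasing_set_cvg_integral => //.
- apply/nondecreasing_seqP => n; rewrite subsetEset => x; rewrite /I/= !in_itv/=.
  have : cos (t n) <= cos (t n.+1).
    rewrite leNgt ltr_cos ?in_itv/=.
    + by rewrite -leNgt lef_pV2 ?posrE// ler_nat.
    + by have := t_itv n; have := pi_gt0 R; lra.
    + by have := t_itv n.+1; have := pi_gt0 R; lra.
  by rewrite -(ler_pM2l l0); lra.
- by move=> n; exact: measurable_itv.
- move=> n; apply/measurable_EFinP.
  apply: subspace_continuous_measurable_fun; first exact: measurable_itv.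
  by apply: continuous_in_subspaceT => x; rewrite inE => /I_sub; exact: cf.
- by move=> n x /I_sub /f0; rewrite lee_fin.
Qed.

Lemma is_derive_continuous (R : realType) (f : R -> R) (x df : R) :
  is_derive x 1 f df -> {for x, continuous f}.
Proof.
by move=> [dfx _]; exact/differentiable_continuous/derivable1_diffP.
Qed.

(** With [x = q - 2 s cos t] the denominator is [s |1 - r e^(it)|^2]. *)
Lemma semicircle_denominator_gt0 (R : realType) (q s r x : R) :
  0 < s -> r != 0 -> q - 2 * s < x < q + 2 * s ->
  0 < s * (1 + r ^+ 2) - r * (q - x).
Proof.
move=> s0 r0 xq.
have : `|r * (q - x)| < `|r| * (2 * s).
  by rewrite normrM ltr_pM2l ?normr_gt0// ltr_norml; lra.
have : 0 <= s * (1 - `|r|) ^+ 2 by rewrite mulr_ge0 ?sqr_ge0 ?ltW.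
rewrite -(real_normK (num_real r)) ltr_norml; set a := `|r|; set w := r * _.
nra.
Qed.

(** The derivative is the Poisson kernel.  For [|r| < 1] the primitive is the
    term by term primitive [t + 2 \sum_n r^n sin (n t) / n] of its Fourier
    series, the series being the imaginary part of [- ln (1 - r e^(it))]. *)
Lemma is_derive_poisson_primitive (R : realType) (r t : R) :
  1 - r * cos t != 0 ->
  is_derive t 1 (fun u => u + 2 * atan (r * sin u / (1 - r * cos u)))
    ((1 - r ^+ 2) / (1 + r ^+ 2 - 2 * r * cos t)).
Proof.
move=> D0.
pose N (u : R) := r * sin u.
pose D (u : R) := 1 - r * cos u.
have dN : is_derive t 1 N (r * cos t).
  by apply: is_derive_eq; rewrite /GRing.scale/=; ring.
have dD : is_derive t 1 D (r * sin t).
  by apply: is_derive_eq; rewrite /GRing.scale/=; ring.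
have dV := is_deriveV (f := D) D0 dD.
pose Q u := N u / D u.
have dQ : is_derive t 1 Q
    (N t * (- D t ^- 2 * (r * sin t)) + (D t)^-1 * (r * cos t)).
  exact: is_deriveM.
have datan := is_derive1_comp (g := Q) (is_derive1_atan (Q t)) dQ.
have dG : is_derive t 1 (fun u => u + 2 * (atan \o Q) u)
   (1 + 2 * ((1 + Q t ^+ 2)^-1 *
     (N t * (- D t ^- 2 * (r * sin t)) + (D t)^-1 * (r * cos t)))).
  by apply: is_derive_eq; rewrite /GRing.scale/=.
apply: is_derive_eq; rewrite /Q /N.
have rE : r ^+ 2 = (r * cos t) ^+ 2 + (r * sin t) ^+ 2.
  by rewrite !exprMn -mulrDr cos2Dsin2 mulr1.
have Dgt0 : 0 < D t ^+ 2 by rewrite exprn_even_gt0.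
have DE : 1 + r ^+ 2 - 2 * r * cos t = D t ^+ 2 + (r * sin t) ^+ 2.
  by rewrite rE /D; ring.
have QE : 1 + (r * sin t / D t) ^+ 2 = (D t ^+ 2 + (r * sin t) ^+ 2) / D t ^+ 2.
  by field.
have S0 : D t ^+ 2 + (r * sin t) ^+ 2 != 0 by rewrite gt_eqF// ltr_wpDr// sqr_ge0.
rewrite QE DE rE; move: S0 D0; rewrite -/(D t).
have -> : r * cos t = 1 - D t by rewrite /D; ring.
move=> S0 D0.
by field; rewrite S0 D0.
Qed.

(** After the substitution the integral is [4 s] times that of
    [sin t ^+ 2 / E] over [[0, pi]], where [E = 1 + r ^+ 2 - 2 r cos t].
    As [4 r ^+ 2 sin t ^+ 2] equals
    [- (1 - r ^+ 2) ^+ 2 + 2 (1 + r ^+ 2) E - E ^+ 2], division by [E] leaves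
    an affine function of [cos t] and a multiple of the Poisson kernel; their
    integrals add up to [pi / 2] whatever [r] is.  The value [r = 1] is
    needed for the Marchenko-Pastur law with [c = 1], whose density is
    unbounded at [0]. *)
Lemma integral_semicircle (R : realType) (q s r : R) :
  0 < s -> r != 0 -> -1 <= r <= 1 ->
  (\int[lebesgue_measure]_(x in `](q - 2 * s)%R, (q + 2 * s)%R[)
     (Num.sqrt ((2 * s) ^+ 2 - (x - q) ^+ 2) /
      (s * (1 + r ^+ 2) - r * (q - x)))%:E = (2 * pi * s)%:E)%E.
Proof.
move=> s0 r0 r1.
have l0 : 0 < 2 * s by lra.
pose G t := t + 2 * atan (r * sin t / (1 - r * cos t)).
pose A t := s / r ^+ 2 * ((1 + r ^+ 2) * t + 2 * r * sin t -
  (1 - r ^+ 2) * G t).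
have -> : 2 * pi * s = A pi - A 0.
  by rewrite /A /G sinpi sin0 !mulr0 !mul0r atan0; field; rewrite r0.
have dG t : 1 - r * cos t != 0 ->
    is_derive t 1 G ((1 - r ^+ 2) / (1 + r ^+ 2 - 2 * r * cos t)).
  exact: is_derive_poisson_primitive.
have cA t : (r ^+ 2 != 1 -> 1 - r * cos t != 0) -> {for t, continuous A}.
  move=> D0.
  have dB : is_derive t 1 (fun u : R => (1 + r ^+ 2) * u + 2 * r * sin u)
      (1 + r ^+ 2 + 2 * r * cos t).
    by apply: is_derive_eq; rewrite /GRing.scale/=; ring.
  apply: cvgM; first exact: cvg_cst.
  (* for [r = 1] or [r = -1] the denominator in [G] vanishes at one of the end
     points, but then so does the coefficient [1 - r ^+ 2] of [G] *)
  have [r21|r21] := eqVneq (r ^+ 2) 1.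
    have r20 : 1 - r ^+ 2 = 0 by rewrite r21 subrr.
    under eq_fun do rewrite r20 mul0r subr0.
    by rewrite r20 mul0r subr0; exact: is_derive_continuous dB.
  apply: cvgB; first exact: is_derive_continuous dB.
  apply: cvgM; first exact: cvg_cst.
  exact: is_derive_continuous (dG t (D0 r21)).
have D0 t : 0 < t < pi -> 1 - r * cos t != 0.
  move=> /andP[t0 tpi].
  have c1 : cos t < 1.
    by rewrite -[ltRHS]cos0 ltr_cos// in_itv/= ?lexx ?pi_ge0// !ltW.
  have c2 : -1 < cos t.
    by rewrite -cospi ltr_cos// in_itv/= ?lexx ?pi_ge0// !ltW.
  by rewrite gt_eqF//; nra.
pose f (x : R) := Num.sqrt ((2 * s) ^+ 2 - (x - q) ^+ 2) /
  (s * (1 + r ^+ 2) - r * (q - x)).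
rewrite -[LHS]/(\int[lebesgue_measure]_(x in
  `](q - 2 * s)%R, (q + 2 * s)%R[) (f x)%:E)%E.
apply: (@ge0_integral_cos_substitution _ q (2 * s) f A l0).
- move=> x xq; rewrite divr_ge0// ltW// semicircle_denominator_gt0//.
- move=> x xq.
  have d1 : is_derive x 1 (fun y : R => (2 * s) ^+ 2 - (y - q) ^+ 2)
      (- (2 * (x - q))).
    by apply: is_derive_eq; rewrite /GRing.scale/=; ring.
  have d2 : is_derive x 1 (fun y : R => s * (1 + r ^+ 2) - r * (q - y)) r.
    by apply: is_derive_eq; rewrite /GRing.scale/=; ring.
  apply: cvgM.
    apply: continuous_cvg; first exact: sqrt_continuous.
    exact: is_derive_continuous d1.
  apply: cvgV; first by rewrite gt_eqF// semicircle_denominator_gt0.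
  exact: is_derive_continuous d2.
- apply: cA => r21; rewrite cos0 mulr1; apply: contraNneq r21 => h.
  have -> : r = 1 by lra.
  by rewrite expr1n.
- apply: cA => r21; rewrite cospi; apply: contraNneq r21 => h.
  have -> : r = -1 by lra.
  by rewrite sqrrN expr1n.
move=> t t0pi.
have s1 : 0 < sin t by exact: sin_gt0_pi.
have dGt := dG t (D0 t t0pi).
have Egt0 : 0 < 1 + r ^+ 2 - 2 * r * cos t.
  have -> : 1 + r ^+ 2 - 2 * r * cos t =
      (1 - r * cos t) ^+ 2 + (r * sin t) ^+ 2.
    have -> : r ^+ 2 = (r * cos t) ^+ 2 + (r * sin t) ^+ 2.
      by rewrite !exprMn -mulrDr cos2Dsin2 mulr1.
    by ring.
  by rewrite ltr_wpDr ?sqr_ge0// exprn_even_gt0//= D0.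
rewrite /f.
have -> : (2 * s) ^+ 2 - (q - 2 * s * cos t - q) ^+ 2 = (2 * s * sin t) ^+ 2.
  by rewrite [in RHS]exprMn (_ : sin t ^+ 2 = 1 - cos t ^+ 2);
    [ring|rewrite -(cos2Dsin2 t) addrC addKr].
rewrite sqrtr_sqr ger0_norm; last by rewrite !mulr_ge0// ltW.
apply: is_derive_eq; rewrite /GRing.scale/=.
have sinE : sin t * sin t = 1 - cos t ^+ 2 by rewrite -(cos2Dsin2 t) addrC addKr.
transitivity (4 * s * (sin t * sin t) / (1 + r ^+ 2 - 2 * r * cos t)).
  by rewrite sinE; field; rewrite r0 gt_eqF.
field.
rewrite (lt0r_neq0 Egt0) andbT; apply: lt0r_neq0.
have -> : s * (1 + r ^+ 2) - r * (q - (q - 2 * s * cos t)) =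
  s * (1 + r ^+ 2 - 2 * r * cos t) by ring.
exact: mulr_gt0.
Qed.

(** * Integration against a measure with a density *)

(** For simple [h] this is the hypothesis on [nu] and linearity; in general
    [h] is the nondecreasing limit of its simple approximations [g n]. *)
Lemma ge0_integral_density (d : measure_display) (T : measurableType d)
  (R : realType) (mu nu : {measure set T -> \bar R}) (f : T -> R)
  (D : set T) (h : T -> \bar R) :
  (forall x, 0 <= f x) -> measurable_fun setT f ->
  (forall A, measurable A -> nu A = (\int[mu]_(x in A) (f x)%:E)%E) ->
  measurable D -> measurable_fun D h -> (forall x, D x -> (0 <= h x)%E) ->
  (\int[nu]_(x in D) h x = \int[mu]_(x in D) (h x * (f x)%:E))%E.
Proof.
move=> f0 mf nuE mD mh h0; pose g := nnsfun_approx mD mh.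
have mfE : measurable_fun D (EFin \o f).
  by apply/measurable_funTS/measurable_EFinP.
have mg n : measurable_fun D (EFin \o g n).
  by apply/measurable_funTS/measurable_EFinP.
have nu_g n :
    (\int[nu]_(x in D) (g n x)%:E = \int[mu]_(x in D) ((g n x)%:E * (f x)%:E))%E.
  have indich r : measurable_fun D (fun x => (r * \1_(g n @^-1` [set r]) x)%:E).
    by apply/measurable_funTS/measurable_EFinP; exact: measurable_funM.
  under eq_integral do rewrite fimfunE -fsumEFin//.
  rewrite ge0_integral_fsum//; last by move=> m y Ey; exact: nnfun_muleindic_ge0.
  under [RHS]eq_integral => x xE.
    rewrite fimfunE -fsumEFin// ge0_mule_fsuml => [|y]; last exact: nnfun_muleindic_ge0.
    over.
  rewrite ge0_integral_fsum//; last 2 first.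
  - by move=> r; exact: emeasurable_funM.
  - by move=> r x Dx; rewrite mule_ge0 ?lee_fin// -lee_fin EFinM nnfun_muleindic_ge0.
  apply: eq_fsbigr => r /[!inE] -[x0 _ gr].
  have r0 : 0 <= r by rewrite -gr.
  have mr : measurable (g n @^-1` [set r]) by exact: measurable_sfunP.
  transitivity (r%:E * nu (g n @^-1` [set r] `&` D))%E.
    under eq_integral do rewrite EFinM.
    by rewrite ge0_integralZl_EFin ?integral_indic//; apply/measurable_EFinP.
  rewrite nuE; last exact: measurableI.
  rewrite setIC integral_mkcondr -ge0_integralZl_EFin//; last 2 first.
  - by move=> x Dx; rewrite erestrict_ge0// => y _; rewrite lee_fin.
  - by apply/measurable_restrict => //; apply: measurable_funS mfE.
  apply: eq_integral => x _; rewrite EFinM -muleA; congr (_ * _)%E.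
  by rewrite muleC epatch_indic.
transitivity (limn (fun n => \int[nu]_(x in D) (g n x)%:E)%E).
  have hE x : D x -> h x = limn (EFin \o g^~ x).
    by move=> Dx; apply/esym/cvg_lim => //; exact: cvg_nnsfun_approx.
  under eq_integral => x /[!inE] /hE -> //.
  apply: monotone_convergence => //.
  - by move=> n x Dx; rewrite lee_fin.
  - by move=> x Dx a b ab; rewrite lee_fin; exact/lefP/nd_nnsfun_approx.
under eq_fun do rewrite nu_g.
have hfE x : D x -> (h x * (f x)%:E)%E = limn (fun n => (g n x)%:E * (f x)%:E)%E.
  move=> Dx; apply/esym/cvg_lim => //; apply: cvgeZr => //.
  exact: cvg_nnsfun_approx.
under [RHS]eq_integral => x /[!inE] /hfE -> //.
apply/esym/monotone_convergence => //.
- by move=> n; apply: emeasurable_funM; [exact: mg|exact: mfE].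
- by move=> n x Dx; rewrite mule_ge0 ?lee_fin.
- move=> x Dx a b ab; rewrite lee_wpmul2r ?lee_fin//.
  exact/lefP/nd_nnsfun_approx.
Qed.

(** * Mass and support of the Marchenko-Pastur law *)

(** Since [0^-1 = 0], the inverse of [y] is always [y * (y ^+ 2) `^ (-1)],
    and real powers are measurable. *)
Lemma measurable_fun_inv (d : measure_display) (T : measurableType d)
  (R : realType) (D : set T) (f : T -> R) :
  measurable_fun D f -> measurable_fun D (fun x => (f x)^-1).
Proof.
move=> mf.
rewrite (_ : (fun x => _) = (fun x => f x * (f x ^+ 2) `^ (-1))).
  apply: measurable_funM => //.
  apply: (@measurableT_comp _ _ _ _ _ _ (fun y : R => y `^ (-1))) => //.
  exact: measurable_funX.
apply/funext => x; rewrite powR_inv1 ?sqr_ge0//.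
have [->|fx0] := eqVneq (f x) 0; first by rewrite invr0 mul0r.
by field.
Qed.

Lemma mp_loE (R : realType) (c : R) : 0 < c ->
  mp_lo c = (1 + c) - 2 * Num.sqrt c.
Proof. by move=> c0; rewrite /mp_lo -{2}(sqr_sqrtr (ltW c0)); ring. Qed.

Lemma mp_hiE (R : realType) (c : R) : 0 < c ->
  mp_hi c = (1 + c) + 2 * Num.sqrt c.
Proof. by move=> c0; rewrite /mp_hi -{2}(sqr_sqrtr (ltW c0)); ring. Qed.

Lemma mp_density_in (R : realType) (c x : R) : 0 < c -> mp_lo c < x < mp_hi c ->
  mp_density c x =
  Num.sqrt ((2 * Num.sqrt c) ^+ 2 - (x - (1 + c)) ^+ 2) / (2 * pi * c * x).
Proof.
move=> c0 /andP[lx xh]; rewrite /mp_density indicE mem_set/=; last first.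
  by rewrite in_itv/= !ltW.
by rewrite mul1r mp_hiE// mp_loE//; congr (Num.sqrt _ / _); ring.
Qed.

(** The indicator in the density is that of the closed interval, but the
    square root vanishes at its end points. *)
Lemma mp_density_out (R : realType) (c x : R) : ~~ (mp_lo c < x < mp_hi c) ->
  mp_density c x = 0.
Proof.
rewrite /mp_density indicE => xI.
have [|_] := boolP (x \in _); last by rewrite mul0r.
rewrite inE/= in_itv/= => /andP[]; rewrite le_eqVlt => /predU1P[->|lx].
  by rewrite subrr mulr0 sqrtr0 mul0r mulr0.
rewrite le_eqVlt => /predU1P[->|xh]; last by rewrite lx xh in xI.
by rewrite subrr mul0r sqrtr0 mul0r mulr0.
Qed.

Lemma MP_null (R : realType) (c : R) (A : set (measurableTypeR R)) :
  A `&` `]mp_lo c, mp_hi c[ = set0 -> MP c A = 0%E.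
Proof.
move=> AI; rewrite /MP integral0_eq// => x Ax; rewrite mp_density_out//.
apply/negP => xI; suff : set0 x by [].
by rewrite -AI; split => //=; rewrite in_itv.
Qed.

Lemma measurable_semicircle (R : realType) (q s r : R) (D : set R) :
  measurable_fun D (fun x => Num.sqrt ((2 * s) ^+ 2 - (x - q) ^+ 2) /
      (s * (1 + r ^+ 2) - r * (q - x))).
Proof.
apply: measurable_funTS; apply: measurable_funM.
  apply: (@measurableT_comp _ _ _ _ _ _ (@Num.sqrt R)).
    by apply: continuous_measurable_fun; exact: sqrt_continuous.
  by apply: measurable_funB => //; apply: measurable_funX; exact: measurable_funB.
apply: measurable_fun_inv; apply: measurable_funB => //.
by apply: measurable_funM => //; exact: measurable_funB.
Qed.

(** The weight [1 / x] is the case [r = Num.sqrt c] of the kernels integrated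
    by [integral_semicircle]. *)
Lemma mp_density_semicircle (R : realType) (c x : R) (s := Num.sqrt c) :
  0 < c -> mp_lo c < x < mp_hi c ->
  mp_density c x = s / (2 * pi * c) *
    (Num.sqrt ((2 * s) ^+ 2 - (x - (1 + c)) ^+ 2) /
      (s * (1 + s ^+ 2) - s * (1 + c - x))).
Proof.
move=> c0 xI; have s0 : s != 0 by rewrite gt_eqF// sqrtr_gt0.
have sE : s ^+ 2 = c by rewrite sqr_sqrtr ?ltW.
have x0 : x != 0.
  by case/andP: xI => lx _; rewrite gt_eqF// (le_lt_trans _ lx)// sqr_ge0.
rewrite mp_density_in// -/s.
have -> : s * (1 + s ^+ 2) - s * (1 + c - x) = s * x by rewrite sE; ring.
move: (pi_gt0 R); move: (pi : R) => p p0.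
by field; rewrite s0 x0 !lt0r_neq0.
Qed.

Lemma MP_setT (R : realType) (c : R) : 0 < c -> c <= 1 ->
  MP c setT = 1%E.
Proof.
move=> c0 c1; have s0 : 0 < Num.sqrt c by rewrite sqrtr_gt0.
have s1 : Num.sqrt c <= 1 by rewrite -sqrtr1 ler_sqrt.
transitivity (\int[lebesgue_measure]_(x in `]mp_lo c, mp_hi c[) (mp_density c x)%:E)%E.
  rewrite /MP [RHS]integral_mkcond; apply: eq_integral => x _.
  rewrite patchE; case: ifPn => //; rewrite notin_setE/= in_itv/= => /negP xI.
  by rewrite mp_density_out.
under eq_integral => x.
  rewrite inE/= in_itv/= => xI; rewrite mp_density_semicircle// EFinM; over.
rewrite mp_loE// mp_hiE//= ge0_integralZl_EFin//.
- rewrite integral_semicircle// ?gt_eqF//; last lra.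
  rewrite -EFinM; congr EFin; rewrite -{2}(sqr_sqrtr (ltW c0)).
  move: (pi_gt0 R); move: (pi : R) => p p0.
  by field; rewrite !lt0r_neq0.
- move=> x /=; rewrite in_itv/= => xI; rewrite lee_fin divr_ge0// ltW//.
  by rewrite semicircle_denominator_gt0// gt_eqF.
- by apply/measurable_EFinP; exact: measurable_semicircle.
- by rewrite divr_ge0// ?mulr_ge0// ltW// pi_gt0.
Qed.

(** The right end point [mp_hi c] is in the support, because the density is
    positive on its left: a neighbourhood of measure zero would make the
    density vanish almost everywhere on an interval of positive length. *)
Lemma edge_MP (R : realType) (c : R) : 0 < c -> edge (MP c) = 1 + Num.sqrt c.
Proof.
move=> c0; have s0 : 0 < Num.sqrt c by rewrite sqrtr_gt0.
have lohi : mp_lo c < mp_hi c by rewrite mp_loE// mp_hiE//; lra.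
have ub : ubound (msupport (MP c)) (mp_hi c).
  move=> x xs; rewrite leNgt; apply/negP => xhi.
  have : (0 < MP c `]mp_hi c, +oo[%classic)%E.
    by apply: xs; [exact: rray_open|rewrite /= in_itv/= xhi].
  rewrite MP_null ?ltxx//.
  rewrite -subset0 => y []/=; rewrite !in_itv/= andbT => hy /andP[_].
  by rewrite ltNge (ltW hy).
have hi_in : msupport (MP c) (mp_hi c).
  move=> U oU Uhi; have mU := open_measurable oU.
  rewrite lt0e measure_ge0 andbT; apply/eqP => U0.
  have mf : measurable_fun U (EFin \o mp_density c).
    by apply/measurable_EFinP/measurable_funTS; exact: measurable_mp_density.
  have I0 : (\int[lebesgue_measure]_(x in U) `|(mp_density c x)%:E| = 0)%E.
    rewrite -U0 /MP; apply: eq_integral => x _.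
    by rewrite gee0_abs// lee_fin mp_density_ge0.
  have [N [mN N0 UN]] := (ae_eq_integral_abs lebesgue_measure mU mf).1 I0.
  have [e /= e0 eU] : nbhs_ball (mp_hi c) U by apply/nbhs_ballP/open_nbhs_nbhs.
  pose a := Num.max (mp_hi c - e) (mp_lo c).
  have ahi : a < mp_hi c by rewrite gt_max ltrBlDr ltrDl e0.
  have aN : `]a, mp_hi c[ `<=` N.
    move=> x /=; rewrite in_itv/= gt_max => /andP[/andP[ex lx] xh].
    have Ux : U x by apply: eU; rewrite /ball/= ltr_norml; lra.
    have x0 : 0 < x by rewrite (le_lt_trans _ lx)// sqr_ge0.
    apply: UN => /= /(_ Ux) [] /eqP; apply/negP.
    rewrite mp_density_in ?lx// gt_eqF// divr_gt0//; last first.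
      by rewrite !mulr_gt0// pi_gt0.
    move: lx xh; rewrite mp_loE// mp_hiE// sqrtr_gt0 => lx xh; nra.
  have : (lebesgue_measure `]a, mp_hi c[%classic <= lebesgue_measure N)%E.
    by apply: le_measure; rewrite ?inE.
  rewrite [leRHS]N0 lebesgue_measure_itv/= lte_fin ahi -EFinB lee_fin.
  by lra.
have : sup (msupport (MP c)) = mp_hi c.
  apply/le_anti/andP; split; first by apply: ge_sup => //; exists (mp_hi c).
  by apply: ub_le_sup => //; exists (mp_hi c).
by rewrite /edge => ->; rewrite sqrtr_sqr ger0_norm// addr_ge0// ltW.
Qed.

(** * The Stieltjes-type transforms *)

Lemma Delta_gt0 (R : realType) (c z : R) : 0 < c -> 1 + Num.sqrt c < z ->
  0 < (z ^+ 2 - mp_lo c) * (z ^+ 2 - mp_hi c).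
Proof.
move=> c0 bz; have s0 : 0 < Num.sqrt c by rewrite sqrtr_gt0.
have : mp_hi c < z ^+ 2 by rewrite /mp_hi ltr_pXn2r// ?nnegrE; lra.
by rewrite mp_loE// mp_hiE// => zh; rewrite mulr_gt0//; lra.
Qed.

Lemma Delta_above_edge (R : realType) (c z : R)
    (Dl := Num.sqrt ((z ^+ 2 - mp_lo c) * (z ^+ 2 - mp_hi c))) :
  0 < c -> 1 + Num.sqrt c < z ->
  [/\ 0 < z, 0 < Dl, Dl ^+ 2 = (z ^+ 2 - (1 + c)) ^+ 2 - 4 * c &
      2 * Num.sqrt c < z ^+ 2 - (1 + c)].
Proof.
move=> c0 bz; have D2gt0 := Delta_gt0 c0 bz.
have s0 : 0 < Num.sqrt c by rewrite sqrtr_gt0.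
have hz : mp_hi c < z ^+ 2 by rewrite /mp_hi ltr_pXn2r// ?nnegrE; lra.
split; [lra|by rewrite sqrtr_gt0| |by move: hz; rewrite mp_hiE//; lra].
rewrite sqr_sqrtr ?ltW// mp_loE// mp_hiE//.
by rewrite -[in 4 * c](sqr_sqrtr (ltW c0)); ring.
Qed.

(** By partial fractions [z / (x (z ^+ 2 - x))] is [z^-1] times
    [x^-1 + (z ^+ 2 - x)^-1], and both terms are kernels of
    [integral_semicircle]: the first with parameter [s = Num.sqrt c], the
    second with parameter [- r], where [0 < r <= 1] and
    [s (r + r^-1) = z ^+ 2 - (1 + c)].  The result is
    [phi z = (1 + r / s) / z]. *)
Lemma phi_MP (R : realType) (c z : R) :
  0 < c -> c <= 1 -> 1 + Num.sqrt c < z ->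
  phi (MP c) z =
  (z ^+ 2 + c - 1 - Num.sqrt ((z ^+ 2 - mp_lo c) * (z ^+ 2 - mp_hi c))) /
  (2 * c * z).
Proof.
move=> c0 c1 bz; have [z0 D0 DE y2s] := Delta_above_edge c0 bz.
have s0 : 0 < Num.sqrt c by rewrite sqrtr_gt0.
have sE : Num.sqrt c ^+ 2 = c by rewrite sqr_sqrtr ?ltW.
have s1 : Num.sqrt c <= 1 by rewrite -sqrtr1 ler_sqrt.
set Dl := Num.sqrt (_ * _) in D0 DE *.
set s := Num.sqrt c in s0 sE s1 bz y2s *.
set y := z ^+ 2 - (1 + c) in DE y2s.
(* the root in ]0, 1] of [s * (r + r^-1) = y] *)
pose r := (y - Dl) / (2 * s).
have srE : 2 * s * r = y - Dl by rewrite /r; field; rewrite lt0r_neq0.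
have r0 : 0 < r.
  rewrite divr_gt0 ?mulr_gt0// subr_gt0.
  by rewrite -(@ltr_pXn2r _ 2)// ?nnegrE ?ltW//; lra.
have r1 : r <= 1.
  rewrite ler_pdivrMr ?mulr_gt0// mul1r lerBlDl -lerBlDr.
  by rewrite -(@ler_pXn2r _ 2)// ?nnegrE; nra.
have rE : s * (1 + r ^+ 2) = r * y.
  have DlE : Dl = y - 2 * s * r by rewrite srE; ring.
  move: DE; rewrite DlE -sE => DE; apply: (mulfI (lt0r_neq0 s0)); lra.
pose D := `]mp_lo c, mp_hi c[%classic.
have mD : measurable (D : set (measurableTypeR R)) by exact: measurable_itv.
have mg (A : set (measurableTypeR R)) :
    measurable_fun A (fun x => (z / (z ^+ 2 - x))%:E).
  apply/measurable_funTS/measurable_EFinP; apply: measurable_funM => //.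
  by apply: measurable_fun_inv; exact: measurable_funB.
have DxE x : D x -> mp_lo c < x < z ^+ 2.
  rewrite /D/= in_itv/= => /andP[-> xh]; rewrite (lt_trans xh)//.
  by rewrite mp_hiE// -/s; move: y2s; rewrite /y; lra.
rewrite /phi /Rintegral.
have -> : (\int[MP c]_x (z / (z ^+ 2 - x))%:E =
    \int[MP c]_(x in D) (z / (z ^+ 2 - x))%:E)%E.
  rewrite -(setvU D) integral_setU//; last 2 first.
  - exact: measurableC.
  - by rewrite disj_set2E setICl.
  rewrite null_set_integral ?add0e//; first exact: measurableC.
  by apply: MP_null; rewrite setICl.
rewrite (@ge0_integral_density _ _ _ lebesgue_measure _ (mp_density c))//; last 3 first.
- exact: mp_density_ge0.
- exact: measurable_mp_density.
- by move=> x /DxE/andP[_ xz]; rewrite lee_fin divr_ge0 ?(ltW z0)// subr_ge0 ltW.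
pose h (t x : R) := Num.sqrt ((2 * s) ^+ 2 - (x - (1 + c)) ^+ 2) /
  (s * (1 + t ^+ 2) - t * (1 + c - x)).
have mh t (a : R) : measurable_fun (D : set (measurableTypeR R))
    (fun x => (a * h t x)%:E).
  apply/measurable_EFinP; apply: measurable_funM => //.
  exact: measurable_semicircle.
have h0 t (a : R) : t != 0 -> 0 <= a -> forall x, D x -> (0 <= (a * h t x)%:E)%E.
  move=> t0 a0 x; rewrite /D/= in_itv/= mp_loE// mp_hiE// => xI.
  rewrite lee_fin mulr_ge0// divr_ge0 ?sqrtr_ge0// ltW//.
  exact: semicircle_denominator_gt0.
have Ih t (a : R) : 0 <= a -> t != 0 -> -1 <= t <= 1 ->
    (\int[lebesgue_measure]_(x in D) (a * h t x)%:E = (a * (2 * pi * s))%:E)%E.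
  move=> a0 t0 t1; under eq_integral do rewrite EFinM.
  rewrite ge0_integralZl_EFin//.
  - by rewrite /D mp_loE// mp_hiE// integral_semicircle.
  - by move=> x Dx; have := h0 t 1 t0 ler01 x Dx; rewrite mul1r.
  - by have := mh t 1; under eq_fun do rewrite mul1r.
pose k := 2 * pi * c * z.
have k0 : 0 < k by rewrite !mulr_gt0// pi_gt0.
have r0' : r != 0 by rewrite lt0r_neq0.
have s0' : s != 0 by rewrite lt0r_neq0.
under eq_integral => x.
  rewrite inE => Dx; rewrite -EFinM.
  have -> : z / (z ^+ 2 - x) * mp_density c x =
    s / k * h s x + r / k * h (- r) x.
    have /andP[lx xz] := DxE _ Dx.
    have x0 : 0 < x by rewrite (le_lt_trans _ lx)// sqr_ge0.
    have xz0 : 0 < z ^+ 2 - x by rewrite subr_gt0.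
    rewrite /h.
    have -> : s * (1 + s ^+ 2) - s * (1 + c - x) = s * x by rewrite sE; ring.
    have -> : s * (1 + (- r) ^+ 2) - (- r) * (1 + c - x) = r * (z ^+ 2 - x).
      by rewrite sqrrN rE /y; ring.
    rewrite mp_density_in// -/s /k.
    move: (pi_gt0 R); move: (pi : R) => p p0.
    by field; rewrite !lt0r_neq0.
  rewrite EFinD; over.
rewrite ge0_integralD//; last 2 first.
- by apply: h0 => //; rewrite divr_ge0 ?ltW.
- by apply: h0; [rewrite oppr_eq0|rewrite divr_ge0 ?ltW].
have sk0 : 0 <= s / k by rewrite divr_ge0 ?ltW.
have rk0 : 0 <= r / k by rewrite divr_ge0 ?ltW.
rewrite Ih//; last by lra.
rewrite Ih ?oppr_eq0//; last by lra.
rewrite -EFinD /fine.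
have -> : z ^+ 2 + c - 1 - Dl = 2 * s ^+ 2 + 2 * s * r by rewrite srE sE /y; ring.
rewrite /k -[in LHS]sE -[in RHS]sE.
move: (pi_gt0 R); move: (pi : R) => p p0.
by field; rewrite !lt0r_neq0.
Qed.

(** * Closed form, injectivity and derivative of the product transform *)

Lemma phit_MP (R : realType) (c z : R) :
  0 < c -> c <= 1 -> 1 + Num.sqrt c < z ->
  phit c (MP c) z =
  (z ^+ 2 - c + 1 - Num.sqrt ((z ^+ 2 - mp_lo c) * (z ^+ 2 - mp_hi c))) /
  (2 * z).
Proof.
move=> c0 c1 bz; have [z0 _ _ _] := Delta_above_edge c0 bz.
by rewrite /phit phi_MP//; field; rewrite !lt0r_neq0.
Qed.

Lemma dtrans_MP (R : realType) (c z : R) :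
  0 < c -> c <= 1 -> 1 + Num.sqrt c < z ->
  dtrans c (MP c) z = 2 / (z ^+ 2 - (1 + c) +
    Num.sqrt ((z ^+ 2 - mp_lo c) * (z ^+ 2 - mp_hi c))).
Proof.
move=> c0 c1 bz; have [z0 D0 DE yz] := Delta_above_edge c0 bz.
rewrite /dtrans phit_MP// phi_MP//.
have s0 : 0 < Num.sqrt c by rewrite sqrtr_gt0.
set Dl := Num.sqrt (_ * _) in D0 DE *.
have yD0 : 0 < z ^+ 2 - (1 + c) + Dl by lra.
rewrite mulf_div; apply/eqP; rewrite eqr_div ?mulf_neq0 ?lt0r_neq0// ?mulr_gt0//.
apply/eqP; transitivity (2 * z ^+ 2 * ((z ^+ 2 - (1 + c)) ^+ 2 - Dl ^+ 2)); last first.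
  by rewrite DE; ring.
transitivity ((z ^+ 4 - 2 * z ^+ 2 * Dl + Dl ^+ 2 - (1 - c) ^+ 2) *
   (z ^+ 2 - (1 + c) + Dl)); first by ring.
by rewrite DE; ring: DE.
Qed.

(** The closed form says that [(dtrans z)^-1] is the larger root of
    [v ^+ 2 - (z ^+ 2 - (1 + c)) v + c]; the other root is then
    [c * dtrans z].  Hence [z ^+ 2] is a function of [dtrans z], which is what
    makes [dtrans] injective and its inverse explicit. *)
Lemma dtrans_functional_equation (R : realType) (c z : R) :
  0 < c -> c <= 1 -> 1 + Num.sqrt c < z ->
  (dtrans c (MP c) z)^-1 + c * dtrans c (MP c) z = z ^+ 2 - (1 + c).
Proof.
move=> c0 c1 bz; have [z0 D0 DE yz] := Delta_above_edge c0 bz.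
have s0 : 0 < Num.sqrt c by rewrite sqrtr_gt0.
rewrite dtrans_MP//; set Dl := Num.sqrt (_ * _) in D0 DE *.
set y := z ^+ 2 - (1 + c) in DE yz *.
have yD0 : 0 < y + Dl by lra.
have cE : 4 * c = y ^+ 2 - Dl ^+ 2 by rewrite DE; ring.
have -> : c = (y ^+ 2 - Dl ^+ 2) / 4 by rewrite -cE; field.
by field; rewrite lt0r_neq0.
Qed.

Lemma dtrans_inj (R : realType) (c : R) : 0 < c -> c <= 1 ->
  {in `]1 + Num.sqrt c, +oo[ &, injective (dtrans c (MP c))}.
Proof.
move=> c0 c1 z w; rewrite !in_itv/= !andbT => bz bw dzw.
have s0 : 0 < Num.sqrt c by rewrite sqrtr_gt0.
have := dtrans_functional_equation c0 c1 bz.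
rewrite dzw dtrans_functional_equation// => /addIr/eqP.
rewrite eqrXn2//; [by move/eqP|lra|lra].
Qed.

(** Writing [z ^+ 2 - (1 + c)] as [T + c / T] makes the radicand a square;
    [T] will be [theta ^+ 2], and [T > Num.sqrt c] selects the branch. *)
Lemma Delta_joukowski (R : realType) (c T z : R) : 0 < c -> Num.sqrt c < T ->
  z ^+ 2 = T + (1 + c) + c / T ->
  Num.sqrt ((z ^+ 2 - mp_lo c) * (z ^+ 2 - mp_hi c)) = T - c / T.
Proof.
move=> c0 sT zE; have s0 : 0 < Num.sqrt c by rewrite sqrtr_gt0.
have T0 : 0 < T by lra.
have -> : (z ^+ 2 - mp_lo c) * (z ^+ 2 - mp_hi c) = (T - c / T) ^+ 2.
  rewrite zE mp_loE// mp_hiE//.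
  transitivity ((T + c / T) ^+ 2 - 4 * Num.sqrt c ^+ 2); first by ring.
  by rewrite sqr_sqrtr ?ltW//; field; rewrite lt0r_neq0.
rewrite sqrtr_sqr ger0_norm// subr_ge0 ler_pdivrMr//.
by rewrite -[leLHS](sqr_sqrtr (ltW c0)) expr2 ler_pM ?ltW.
Qed.

Lemma edge_lt_joukowski (R : realType) (c T z : R) : 0 < c -> Num.sqrt c < T ->
  0 <= z -> z ^+ 2 = T + (1 + c) + c / T -> 1 + Num.sqrt c < z.
Proof.
move=> c0 sT z0 zE; have s0 : 0 < Num.sqrt c by rewrite sqrtr_gt0.
have T0 : 0 < T by lra.
have b0 : 0 <= 1 + Num.sqrt c by lra.
rewrite -(@ltr_pXn2r _ 2) ?nnegrE//.
rewrite -[_ ^+ 2]/(mp_hi c) mp_hiE// zE.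
suff : 0 < T + c / T - 2 * Num.sqrt c by lra.
have -> : T + c / T - 2 * Num.sqrt c = (T - Num.sqrt c) ^+ 2 / T.
  by rewrite -[in c / T](sqr_sqrtr (ltW c0)); field; rewrite lt0r_neq0.
by rewrite divr_gt0// exprn_gt0// subr_gt0.
Qed.

Lemma dtrans_joukowski (R : realType) (c T z : R) : 0 < c -> c <= 1 ->
  Num.sqrt c < T -> 0 <= z -> z ^+ 2 = T + (1 + c) + c / T ->
  dtrans c (MP c) z = T^-1.
Proof.
move=> c0 c1 sT z0 zE; have s0 : 0 < Num.sqrt c by rewrite sqrtr_gt0.
have T0 : 0 < T by lra.
rewrite dtrans_MP//; last exact: edge_lt_joukowski zE.
rewrite (Delta_joukowski c0 sT zE) zE.
have -> : T + (1 + c) + c / T - (1 + c) + (T - c / T) = 2 * T by ring.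
by field; rewrite lt0r_neq0.
Qed.

(** With [V] the sum of [y = z ^+ 2 - (1 + c)] and [Delta], one has
    [V' = 2 z (1 + y / Delta) = 2 z V / Delta]. *)
Lemma is_derive_dtrans (R : realType) (c z : R)
    (Dl := Num.sqrt ((z ^+ 2 - mp_lo c) * (z ^+ 2 - mp_hi c))) :
  0 < c -> c <= 1 -> 1 + Num.sqrt c < z ->
  is_derive z 1 (dtrans c (MP c)) (- (4 * z / (Dl * (z ^+ 2 - (1 + c) + Dl)))).
Proof.
move=> c0 c1 bz; have [z0 D0 DE yz] := Delta_above_edge c0 bz.
rewrite -/Dl in D0 DE.
have s0 : 0 < Num.sqrt c by rewrite sqrtr_gt0.
have yD0 : z ^+ 2 - (1 + c) + Dl != 0 by rewrite lt0r_neq0//; lra.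
pose P (x : R) := (x ^+ 2 - mp_lo c) * (x ^+ 2 - mp_hi c).
pose V (x : R) := x ^+ 2 - (1 + c) + Num.sqrt (P x).
apply: (@near_eq_is_derive _ _ _ (fun x => 2 * (V x)^-1)).
  near=> x; rewrite dtrans_MP//; near: x; exact: lt_nbhsr.
have dP : is_derive z 1 P (4 * z * (z ^+ 2 - (1 + c))).
  by apply: is_derive_eq; rewrite /GRing.scale/= mp_loE// mp_hiE//; ring.
have Pz0 : 0 < P z by exact: Delta_gt0.
have dS := is_derive1_comp (g := P) (is_derive1_sqrt Pz0) dP.
have dV : is_derive z 1 V (2 * z + (2 * Num.sqrt (P z))^-1 *
   (4 * z * (z ^+ 2 - (1 + c)))).
  by apply: is_derive_eq; rewrite /GRing.scale/=; ring.
have dVi := is_deriveV (f := V) yD0 dV.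
apply: is_derive_eq; rewrite /GRing.scale/= /V -/Dl.
by field; rewrite yD0 lt0r_neq0.
Unshelve. all: by end_near. Qed.

(** [Delta] vanishes at the edge, and [y = z ^+ 2 - (1 + c)] equals
    [2 Num.sqrt c] there. *)
Lemma cvg_dtrans_edge (R : realType) (c : R) : 0 < c -> c <= 1 ->
  dtrans c (MP c) z @[z --> (1 + Num.sqrt c)^'+] --> (Num.sqrt c)^-1.
Proof.
move=> c0 c1; have s0 : 0 < Num.sqrt c by rewrite sqrtr_gt0.
pose b := 1 + Num.sqrt c.
pose P (x : R) := (x ^+ 2 - mp_lo c) * (x ^+ 2 - mp_hi c).
pose V (x : R) := x ^+ 2 - (1 + c) + Num.sqrt (P x).
have VbE : V b = 2 * Num.sqrt c.
  have -> : V b = b ^+ 2 - (1 + c) by rewrite /V /P subrr mulr0 sqrtr0 addr0.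
  by rewrite -/(mp_hi c) mp_hiE//; ring.
have cV : {for b, continuous V}.
  have d1 : is_derive b 1 (fun x : R => x ^+ 2 - (1 + c)) (2 * b).
    by apply: is_derive_eq; rewrite /GRing.scale/=; ring.
  have d2 : is_derive b 1 P (4 * b * (b ^+ 2 - (1 + c))).
    by apply: is_derive_eq; rewrite /GRing.scale/= mp_loE// mp_hiE//; ring.
  apply: cvgD; first exact: is_derive_continuous d1.
  apply: continuous_cvg; first exact: sqrt_continuous.
  exact: is_derive_continuous d2.
have -> : (Num.sqrt c)^-1 = 2 * (V b)^-1 by rewrite VbE; field; rewrite lt0r_neq0.
apply: cvg_trans (cvg_at_right_filter (f := fun x => 2 * (V x)^-1) _).
  apply: near_eq_cvg; near=> x; rewrite dtrans_MP//.
apply: cvgM; first exact: cvg_cst.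
by apply: cvgV => //; rewrite VbE lt0r_neq0// mulr_gt0.
Unshelve. all: by end_near. Qed.

(** * Threshold, inverse function and the kappa coefficients *)

Lemma dtrans_edge_MP (R : realType) (c : R) : 0 < c -> c <= 1 ->
  dtrans_edge c (MP c) = (Num.sqrt c)^-1.
Proof.
by move=> c0 c1; rewrite /dtrans_edge edge_MP//; apply/cvg_lim => //;
  exact: cvg_dtrans_edge.
Qed.

Lemma theta_star_MP (R : realType) (c : R) : 0 < c -> c <= 1 ->
  theta_star c (MP c) = c `^ 4^-1.
Proof.
move=> c0 c1; rewrite /theta_star dtrans_edge_MP//.
rewrite -(powR_inv1 (sqrtr_ge0 c)) -powR12_sqrt ?ltW// -!powRrM.
by congr (_ `^ _); field.
Qed.

(** The right-hand side lies above the edge and is mapped by [dtrans] to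
    [theta ^- 2]; injectivity identifies it with the chosen preimage. *)
Lemma rho_MP (R : realType) (c theta : R) : 0 < c -> c <= 1 ->
  0 < theta -> Num.sqrt c < theta ^+ 2 ->
  rho c (MP c) theta =
  Num.sqrt (theta ^+ 2 + (1 + c) + c / theta ^+ 2).
Proof.
move=> c0 c1 t0 sT; set T := theta ^+ 2 in sT *.
have s0 : 0 < Num.sqrt c by rewrite sqrtr_gt0.
have T0 : 0 < T by lra.
set z := Num.sqrt _.
have zE : z ^+ 2 = T + (1 + c) + c / T.
  by rewrite sqr_sqrtr// !addr_ge0// ?divr_ge0// ?ltW.
have z0 : 0 <= z by exact: sqrtr_ge0.
rewrite /rho edge_MP// -/T -(dtrans_joukowski c0 c1 sT z0 zE) pinvKV//.
  by move=> x y /[!inE]; exact: dtrans_inj.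
by rewrite inE/= in_itv/= (edge_lt_joukowski c0 sT z0 zE).
Qed.

Unset Implicit Arguments.

Theorem proposition8p1 (R : realType) (c : R) (hc0 : 0 < c) (hc1 : c <= 1) :
  let mu : {measure set (measurableTypeR R) -> \bar R} := MP c in
  let b := 1 + Num.sqrt c in
  let Delta (z : R) :=
    Num.sqrt ((z ^+ 2 - mp_lo c) * (z ^+ 2 - mp_hi c)) in
  [/\ mu setT = 1%E /\ edge mu = b,
      (forall z : R, b < z ->
        [/\ phi mu z = (z ^+ 2 + c - 1 - Delta z) / (2 * c * z),
            phit c mu z = (z ^+ 2 - c + 1 - Delta z) / (2 * z) &
            dtrans c mu z = 2 / (z ^+ 2 - (1 + c) + Delta z)]),
      [/\ dtrans c mu z @[z --> b^'+] --> (Num.sqrt c)^-1,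
          dtrans_edge c mu = (Num.sqrt c)^-1 &
          theta_star c mu = c `^ 4^-1] &
      (forall theta : R, c `^ 4^-1 < theta ->
        [/\ b < rho c mu theta /\ dtrans c mu (rho c mu theta) = theta ^- 2,
            rho c mu theta ^+ 2 = theta ^+ 2 + (1 + c) + c / theta ^+ 2 /\
            rho c mu theta ^+ 2 =
              (1 + theta ^+ 2) * (c + theta ^+ 2) / theta ^+ 2,
            kappaL c mu theta = (1 - c / theta ^+ 4) / (1 + c / theta ^+ 2),
            kappaR c mu theta = (1 - c / theta ^+ 4) / (1 + 1 / theta ^+ 2) &
            kappaLR c mu theta =
              Num.sqrt ((1 - c / theta ^+ 4) / (1 + c / theta ^+ 2)) *
              Num.sqrt ((1 - c / theta ^+ 4) / (1 + 1 / theta ^+ 2))])].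
Proof.
move=> mu b Delta; split.
- by split; [exact: MP_setT|exact: edge_MP].
- by move=> z bz; split; [exact: phi_MP|exact: phit_MP|exact: dtrans_MP].
- by split; [exact: cvg_dtrans_edge|exact: dtrans_edge_MP|exact: theta_star_MP].
move=> theta ct.
have s0 : 0 < Num.sqrt c by rewrite sqrtr_gt0.
have t0 : 0 < theta by rewrite (le_lt_trans _ ct)// powR_ge0.
have sT : Num.sqrt c < theta ^+ 2.
  have -> : Num.sqrt c = (c `^ 4^-1) ^+ 2.
    rewrite -powR_mulrn ?powR_ge0// -powRrM -powR12_sqrt ?ltW//.
    by congr (_ `^ _); field.
  by rewrite ltr_pXn2r// ?nnegrE ?powR_ge0// ltW.
have rhoE := rho_MP hc0 hc1 t0 sT; rewrite -/mu in rhoE.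
set z := rho c mu theta in rhoE *.
have T0 : 0 < theta ^+ 2 by rewrite exprn_gt0.
have zE : z ^+ 2 = theta ^+ 2 + (1 + c) + c / theta ^+ 2.
  by rewrite rhoE sqr_sqrtr// !addr_ge0// ?divr_ge0// ?ltW.
have z0 : 0 <= z by rewrite rhoE sqrtr_ge0.
have bz := edge_lt_joukowski hc0 sT z0 zE.
have DE := Delta_joukowski hc0 sT zE.
have zgt0 : 0 < z by lra.
have zE' : z ^+ 2 = (1 + theta ^+ 2) * (c + theta ^+ 2) / theta ^+ 2.
  by rewrite zE; field; rewrite lt0r_neq0.
have tc : 0 < theta ^+ 4 - c.
  rewrite subr_gt0 -[ltLHS](sqr_sqrtr (ltW hc0)).
  rewrite (_ : theta ^+ 4 = (theta ^+ 2) ^+ 2); last by ring.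
  by rewrite ltr_pXn2r// nnegrE ltW.
have dd : (dtrans c mu)^`()%classic z = - (2 * z / (theta ^+ 4 - c)).
  have d := is_derive_dtrans hc0 hc1 bz.
  rewrite derive1E (@derive_val _ _ _ _ _ _ _ d) DE zE.
  have -> : (theta ^+ 2 - c / theta ^+ 2) *
      (theta ^+ 2 + (1 + c) + c / theta ^+ 2 - (1 + c) +
       (theta ^+ 2 - c / theta ^+ 2)) = 2 * (theta ^+ 4 - c).
    by field; rewrite lt0r_neq0.
  by field; rewrite lt0r_neq0.
have phiE : phi mu z = (1 + theta ^- 2) / z.
  rewrite phi_MP// DE zE; field; rewrite !lt0r_neq0//.
have phitE : phit c mu z = (1 + c / theta ^+ 2) / z.
  rewrite phit_MP// DE zE; field; rewrite !lt0r_neq0//.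
split => //.
- split => //; exact: dtrans_joukowski zE.
- rewrite /kappaL -/z dd phiE.
  transitivity ((1 + theta ^- 2) * (theta ^+ 4 - c) / (theta ^+ 2 * z ^+ 2)).
    by field; rewrite !lt0r_neq0.
  by rewrite zE'; field; rewrite !lt0r_neq0// ?addr_gt0// ?ltr01.
- rewrite /kappaR -/z dd phitE.
  transitivity ((1 + c / theta ^+ 2) * (theta ^+ 4 - c) / (theta ^+ 2 * z ^+ 2)).
    by field; rewrite !lt0r_neq0.
  by rewrite zE'; field; rewrite !lt0r_neq0// ?addr_gt0// ?ltr01.
- rewrite /kappaLR -/z dd.
  transitivity ((theta ^+ 4 - c) / (theta ^+ 3 * z)).
    by field; rewrite !lt0r_neq0.
  have num_ge0 : 0 <= 1 - c / theta ^+ 4.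
    by rewrite subr_ge0 ler_pdivrMr ?exprn_gt0// mul1r; lra.
  rewrite -sqrtrM; last by rewrite divr_ge0// addr_ge0// divr_ge0 ?ltW.
  rewrite (_ : _ / _ * _ = ((theta ^+ 4 - c) / (theta ^+ 3 * z)) ^+ 2).
    rewrite sqrtr_sqr ger0_norm// divr_ge0 ?mulr_ge0 ?exprn_ge0// ltW//.
  transitivity ((theta ^+ 4 - c) ^+ 2 / (theta ^+ 6 * z ^+ 2)).
    by rewrite zE'; field; rewrite !lt0r_neq0// ?addr_gt0// ?ltr01.
  by field; rewrite !lt0r_neq0.
Qed.
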